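(* Let $X$ be a set and $\Omega$ a nonempty set disjoint from $X$. Let $j_X:X\hookrightarrow H_{RT}(X,\Omega)$, $x\mapsto\bullet_x$, be the natural embedding and $m_{RT}$ the concatenation product. (a) The sextuple $(H_{RT}(X,\Omega),\,m_{RT},\,1,\,\Delta_{RT},\,\varepsilon_{RT},\,(B_\omega^+)_{\omega\in\Omega})$ together with $j_X$ is the free $\Omega$-cocycle bialgebra on $X$. (b) The Hopf algebra given by the connected graded bialgebra $(H_{RT}(X,\Omega),\,m_{RT},\,1,\,\Delta_{RT},\,\varepsilon_{RT},\,(B_\omega^+)_{\omega\in\Omega})$ together with $j_X$ is the free $\Omega$-cocycle Hopf algebra on $X$.
   Context: $\mathbf{k}$ is a fixed unitary commutative ring; everything is over $\mathbf{k}$ and algebras are unitary associative. Forests: $\mathcal{F}(X,\Omega)$ is the set of planar rooted forests (noncommutative concatenations of planar rooted trees, with $1$ the empty forest) whose vertices are decorated by elements of $X\sqcup\Omega$ such that internal (non-leaf) vertices are decorated by elements of $\Omega$ only; leaves may be decorated by $X$ or $\Omega$, and the vertex of a one-vertex tree counts as a leaf. $\bullet_x$ is the one-vertex tree decorated by $x$. $H_{RT}(X,\Omega):=\mathbf{k}\mathcal{F}(X,\Omega)$. For $\omega\in\Omega$, $B_\omega^+$ is the linear operator sending a forest to the tree obtained by grafting its trees on a new common root decorated by $\omega$, with $B_\omega^+(1)=\bullet_\omega$. Coproduct: a subforest $G$ of a forest $F$ is the forest consisting of a set of vertices of $F$ together with all their descendants and the edges connecting these vertices (including $G=1$ and $G=F$);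 $F/G$ is obtained from $F$ by removing $G$ and the edges connecting $G$ to the rest ($F/F=1$, $F/1=F$). Then $\Delta_{RT}(F)=\sum_G G\otimes(F/G)$, summed over all subforests $G$. Equivalently, $\Delta_{RT}$ is multiplicative, $\Delta_{RT}(1)=1\otimes1$, $\Delta_{RT}(\bullet_x)=\bullet_x\otimes1+1\otimes\bullet_x$ for $x\in X$, and $\Delta_{RT}B_\omega^+(F)=B_\omega^+(F)\otimes1+(\mathrm{id}\otimes B_\omega^+)\Delta_{RT}(F)$. The counit satisfies $\varepsilon_{RT}(1)=1$ and $\varepsilon_{RT}(F)=0$ for forests $F\ne1$. The degree of a forest is its number of vertices; with the resulting grading $H_{RT}(X,\Omega)$ is a connected graded bialgebra, hence a Hopf algebra. An $\Omega$-operated bialgebra is a bialgebra $H$ with a family of linear operators $(P_\omega)_{\omega\in\Omega}$ on $H$; a homomorphism of $\Omega$-operated bialgebras is a bialgebra homomorphism $\phi$ with $\phi P_\omega=P'_\omega\phi$ for all $\omega\in\Omega$. An $\Omega$-cocycle bialgebra is an $\Omega$-operated bialgebra $(H,m,1_H,\Delta,\varepsilon,(P_\omega)_{\omega\in\Omega})$ satisfying $\Delta P_\omega=P_\omega\otimes1_H+(\mathrm{id}\otimes P_\omega)\Delta$ for all $\omega\in\Omega$; it is an $\Omega$-cocycle Hopf algebra if the bialgebra is a Hopf algebra. The free $\Omega$-cocycle bialgebra on $X$ is an $\Omega$-cocycle bialgebra $H_X$ together with a set map $j_X:X\to H_X$ such that, for any $\Omega$-cocycle bialgebra $H$ and any set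 map $f:X\to H$ whose images are primitive (that is, $\Delta(f(x))=f(x)\otimes1_H+1_H\otimes f(x)$ for $x\in X$), there is a unique homomorphism $\bar f:H_X\to H$ of $\Omega$-operated bialgebras with $\bar f j_X=f$. The free $\Omega$-cocycle Hopf algebra on $X$ is defined in the same way, with bialgebras replaced by Hopf algebras. *)

(* Defs.v *)
From HB Require Import structures.
From mathcomp Require Import all_boot all_algebra.
From mathcomp Require Import finmap.
From mathcomp Require Import boolp.
From mathcomp Require Import monalg.

Set Implicit Arguments.
Unset Strict Implicit.
Unset Printing Implicit Defensive.

Import GRing.Theory.
Local Open Scope ring_scope.
Local Open Scope quotient_scope.

HB.lock Definition linear_ext (k : comNzRingType) (K : choiceType)
    (V : lmodType k) (f : K -> V) (x : {malg k[K]}) : V :=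
  \sum_(i <- msupp x) x@_i *: f i.

Arguments linear_ext {k K V} f x.

Section LinearExtension.
Variables (k : comNzRingType) (K : choiceType) (V : lmodType k).

Lemma linear_extEw (f : K -> V) (d : {fset K}) x :
  (msupp x `<=` d)%fset -> linear_ext f x = \sum_(i <- d) x@_i *: f i.
Proof.
move=> le_xd; rewrite linear_ext.unlock (big_fset_incl _ le_xd) //= => i _.
by move/mcoeff_outdom->; rewrite scale0r.
Qed.

Lemma linear_ext_linear (f : K -> V) : linear (linear_ext f).
Proof.
move=> a x y; pose d := (msupp (a *: x + y) `|` (msupp x `|` msupp y))%fset.
have le1 : (msupp (a *: x + y) `<=` d)%fset by apply: fsubsetUl.
have le2 : (msupp x `<=` d)%fset.
  by apply: fsubset_trans (fsubsetUr _ _); apply: fsubsetUl.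
have le3 : (msupp y `<=` d)%fset.
  by apply: fsubset_trans (fsubsetUr _ _); apply: fsubsetUr.
rewrite (linear_extEw _ le1) (linear_extEw _ le2) (linear_extEw _ le3).
rewrite scaler_sumr -big_split /=; apply: eq_bigr => i _.
by rewrite mcoeffD mcoeffZ scalerDl scalerA.
Qed.

HB.instance Definition _ (f : K -> V) :=
  GRing.isLinear.Build k {malg k[K]} V _ (linear_ext f) (linear_ext_linear f).

Lemma linear_extU (f : K -> V) i : linear_ext f << i >> = f i.
Proof. by rewrite (linear_extEw _ msuppU_le) big_seq_fset1 mcoeffUU scale1r. Qed.

End LinearExtension.

(* The tensor product over k of two k-modules: the free module on pairs,       *)
(* modulo the submodule generated by the bilinearity relations.                *)
Section Tensor.
Variables (k : comNzRingType) (V W : lmodType k).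

Inductive bilinearity : {malg k[(V * W)%type]} -> Prop :=
| bilinearityDl v v' w :
    bilinearity (<< (v + v', w) >> - << (v, w) >> - << (v', w) >>)
| bilinearityDr v w w' :
    bilinearity (<< (v, w + w') >> - << (v, w) >> - << (v, w') >>)
| bilinearityZl a v w : bilinearity (<< (a *: v, w) >> - a *: << (v, w) >>)
| bilinearityZr a v w : bilinearity (<< (v, a *: w) >> - a *: << (v, w) >>).

Inductive bilinearity_span : {malg k[(V * W)%type]} -> Prop :=
| bilinearity_span0 : bilinearity_span 0
| bilinearity_spanDZ a r x :
    bilinearity r -> bilinearity_span x -> bilinearity_span (a *: r + x).

Definition tensor_null : {pred {malg k[(V * W)%type]}} :=
  fun x => `[< bilinearity_span x >].

Lemma tensor_nullZD a x y :
  x \in tensor_null -> y \in tensor_null -> a *: x + y \in tensor_null.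
Proof.
move=> /asboolP sx /asboolP sy; apply/asboolP.
elim: sx => [|b r {}x rr _ IH]; first by rewrite scaler0 add0r.
by rewrite scalerDr scalerA -addrA; apply: bilinearity_spanDZ.
Qed.

Lemma tensor_null_zmod_closed : zmod_closed tensor_null.
Proof.
have n0 : 0 \in tensor_null by apply/asboolP; apply: bilinearity_span0.
split=> // x y nx ny.
by rewrite addrC -scaleN1r; apply: tensor_nullZD.
Qed.

HB.instance Definition _ :=
  GRing.isZmodClosed.Build _ tensor_null tensor_null_zmod_closed.

Definition tensor := Quotient.quot tensor_null.

HB.instance Definition _ := GRing.Zmodule.on tensor.
HB.instance Definition _ := EqQuotient.on tensor.

Lemma tensor_piP x y :
  reflect (\pi_tensor x = \pi_tensor y) (x - y \in tensor_null).
Proof. by rewrite Quotient.idealrBE; apply: eqP. Qed.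

Lemma tensor_piD x y : \pi_tensor (x + y) = \pi_tensor x + \pi_tensor y.
Proof. exact: raddfD. Qed.

Definition tensor_scale (a : k) (t : tensor) : tensor :=
  \pi_tensor (a *: repr t).

Lemma tensor_scale_pi a x : tensor_scale a (\pi_tensor x) = \pi_tensor (a *: x).
Proof.
apply/tensor_piP; rewrite -scalerBr -[a *: _]addr0; apply: tensor_nullZD.
  by apply/tensor_piP; rewrite reprK.
by have [] := tensor_null_zmod_closed.
Qed.

Lemma tensor_scaleA a b t :
  tensor_scale a (tensor_scale b t) = tensor_scale (a * b) t.
Proof. by elim/quotW: t => x; rewrite (tensor_scale_pi b) !tensor_scale_pi scalerA. Qed.

Lemma tensor_scale1 : left_id 1 tensor_scale.
Proof. by elim/quotW=> x; rewrite tensor_scale_pi scale1r. Qed.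

Lemma tensor_scaleDr : right_distributive tensor_scale +%R.
Proof.
move=> a; elim/quotW=> x; elim/quotW=> y.
by rewrite -tensor_piD !tensor_scale_pi scalerDr tensor_piD.
Qed.

Lemma tensor_scaleDl t : {morph tensor_scale^~ t : a b / a + b}.
Proof.
by move=> a b; elim/quotW: t => x; rewrite !tensor_scale_pi scalerDl tensor_piD.
Qed.

HB.instance Definition _ := GRing.Zmodule_isLmodule.Build k tensor
  tensor_scaleA tensor_scale1 tensor_scaleDr tensor_scaleDl.

Lemma tensor_piZ a x : \pi_tensor (a *: x) = a *: \pi_tensor x.
Proof. by rewrite [RHS]tensor_scale_pi. Qed.

Lemma tensor_pi_linear : linear (\pi_tensor : {malg k[(V * W)%type]} -> tensor).
Proof. by move=> a x y; rewrite tensor_piD tensor_piZ. Qed.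

Lemma tensor_pi_null x : bilinearity x -> \pi_tensor x = 0.
Proof.
move=> rx; have -> : 0 = \pi_tensor 0 by rewrite raddf0.
apply/tensor_piP; apply/asboolP; rewrite subr0 -[x]scale1r -[_ *: x]addr0.
by apply: bilinearity_spanDZ => //; apply: bilinearity_span0.
Qed.

End Tensor.

HB.lock Definition tens (k : comNzRingType) (V W : lmodType k) (v : V) (w : W) :
    tensor V W :=
  \pi_(tensor V W) << (v, w) >>.

Arguments tens {k V W} v w.
Notation "v *t w" := (tens v w) (at level 40, left associativity) : ring_scope.

Section TensorTheory.
Variables (k : comNzRingType) (V W : lmodType k).
Local Notation tensor := (tensor V W).
Implicit Types (v : V) (w : W).

Lemma tensDl v v' w : tens (v + v') w = tens v w + tens v' w.
Proof.
apply/eqP; rewrite -subr_eq0 opprD addrA tens.unlock -!raddfB /=.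
by rewrite tensor_pi_null //; apply: bilinearityDl.
Qed.

Lemma tensDr v w w' : tens v (w + w') = tens v w + tens v w'.
Proof.
apply/eqP; rewrite -subr_eq0 opprD addrA tens.unlock -!raddfB /=.
by rewrite tensor_pi_null //; apply: bilinearityDr.
Qed.

Lemma tensZl a v w : tens (a *: v) w = a *: tens v w.
Proof.
apply/eqP; rewrite -subr_eq0 tens.unlock -tensor_piZ -!raddfB /=.
by rewrite tensor_pi_null //; apply: bilinearityZl.
Qed.

Lemma tensZr a v w : tens v (a *: w) = a *: tens v w.
Proof.
apply/eqP; rewrite -subr_eq0 tens.unlock -tensor_piZ -!raddfB /=.
by rewrite tensor_pi_null //; apply: bilinearityZr.
Qed.

Lemma tensor_ind (P : tensor -> Prop) :
    P 0 -> (forall s t, P s -> P t -> P (s + t)) ->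
    (forall v w, P (tens v w)) ->
  forall t, P t.
Proof.
move=> P0 PD Pt t; rewrite -[t]reprK [repr t]monalgE raddf_sum /=.
apply: big_ind => // -[v w] _.
have -> : << (repr t)@_(v, w) *g (v, w) >>
    = (repr t)@_(v, w) *: << (v, w) >> :> {malg k[(V * W)%type]}.
  by apply/malgP=> p; rewrite mcoeffZ !mcoeffU mulrnAr mulr1.
by have := Pt ((repr t)@_(v, w) *: v) w; rewrite tensZl tens.unlock tensor_piZ.
Qed.

End TensorTheory.

Section TensorLift.
Variables (k : comNzRingType) (V W U : lmodType k).

Definition bilinear_map (b : V -> W -> U) :=
  (forall w, linear (b^~ w)) /\ (forall v, linear (b v)).

(* The linear map tensor V W -> U induced by b; meaningful for bilinear b only. *)
Definition tensor_lift (b : V -> W -> U) (t : tensor V W) : U :=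
  linear_ext (fun p => b p.1 p.2) (repr t).

Lemma tensor_lift_pi b x : bilinear_map b ->
  tensor_lift b (\pi_(tensor V W) x) = linear_ext (fun p => b p.1 p.2) x.
Proof.
move=> [bl br]; apply/eqP; rewrite -subr_eq0 -linearB /=; apply/eqP.
have /tensor_piP/asboolP :
    \pi_(tensor V W) (repr (\pi_(tensor V W) x)) = \pi_(tensor V W) x.
  by rewrite reprK.
elim=> [|a r y rr _ IH]; first by rewrite linear0.
rewrite linearP /= IH addr0; suff -> : linear_ext (fun p => b p.1 p.2) r = 0.
  by rewrite scaler0.
have blD w : {morph b^~ w : v v' / v + v'}.
  by move=> v v'; have := bl w 1 v v'; rewrite !scale1r.
have brD v : {morph b v : w w' / w + w'}.
  by move=> w w'; have := br v 1 w w'; rewrite !scale1r.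
have bl0 w : b 0 w = 0 by apply: (addrI (b 0 w)); rewrite -blD !addr0.
have br0 v : b v 0 = 0 by apply: (addrI (b v 0)); rewrite -brD !addr0.
case: r / rr => [v v' w|v w w'|c v w|c v w];
  rewrite !linearB ?linearZ /= !linear_extU /= ?blD ?brD.
- by rewrite -addrA -opprD subrr.
- by rewrite -addrA -opprD subrr.
- by have := bl w c v 0; rewrite /= !addr0 bl0 addr0 => ->; rewrite scalerN subrr.
- by have := br v c w 0; rewrite !addr0 br0 addr0 => ->; rewrite scalerN subrr.
Qed.

Lemma tensor_liftE b v w : bilinear_map b -> tensor_lift b (v *t w) = b v w.
Proof. by move=> bb; rewrite tens.unlock tensor_lift_pi // linear_extU. Qed.

Lemma tensor_lift_linear b : bilinear_map b -> linear (tensor_lift b).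
Proof.
move=> bb a; elim/quotW=> x; elim/quotW=> y; rewrite -tensor_piZ -tensor_piD.
by rewrite !tensor_lift_pi // linearP.
Qed.

End TensorLift.

Section TensorMaps.
Variable k : comNzRingType.

Definition tensor_map (V W V' W' : lmodType k) (f : V -> V') (g : W -> W') :
    tensor V W -> tensor V' W' :=
  tensor_lift (fun v w => f v *t g w).

Definition tensor_assoc (U V W : lmodType k) :
    tensor (tensor U V) W -> tensor U (tensor V W) :=
  tensor_lift (fun t w => tensor_lift (fun u v => u *t (v *t w)) t).

End TensorMaps.

HB.lock Definition tensor_mul (k : comNzRingType) (A B : algType k)
    (s t : tensor A B) : tensor A B :=
  tensor_lift (fun a b => tensor_lift (fun c d => (a * c) *t (b * d)) t) s.

(* tensor A B is only a pzRingType: it can be the zero ring. *)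
Section TensorAlgebra.
Variables (k : comNzRingType) (A B : algType k).

Definition tensor_one : tensor A B := 1 *t 1.

Local Notation tensor_mul := (@tensor_mul k A B).

Let inner_bilinear a b :
  bilinear_map (fun (c : A) (d : B) => (a * c) *t (b * d)).
Proof.
by split=> [d|c] x y z /=;
  rewrite mulrDr -scalerAr ?tensDl ?tensDr ?tensZl ?tensZr.
Qed.

Let outer_bilinear t :
  bilinear_map (fun (a : A) (b : B) =>
    tensor_lift (fun c d => (a * c) *t (b * d)) t).
Proof.
split=> [b|a] x y z /=; rewrite /tensor_lift linear_ext.unlock scaler_sumr -big_split;
  apply: eq_bigr => i _ /=; rewrite mulrDl -scalerAl ?tensDl ?tensDr
    ?tensZl ?tensZr scalerDr !scalerA [in RHS]mulrC //.
Qed.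

Lemma tensor_mulE a b c d :
  tensor_mul (a *t b) (c *t d) = (a * c) *t (b * d).
Proof. by rewrite tensor_mul.unlock !tensor_liftE. Qed.

Lemma tensor_mulDl : left_distributive tensor_mul +%R.
Proof.
move=> s t u; rewrite tensor_mul.unlock.
have := tensor_lift_linear (outer_bilinear u) 1 s t.
by rewrite !scale1r.
Qed.

Lemma tensor_mul0l t : tensor_mul 0 t = 0.
Proof. by apply: (addrI (tensor_mul 0 t)); rewrite -tensor_mulDl !addr0. Qed.

Lemma tensor_mulDr : right_distributive tensor_mul +%R.
Proof.
move=> s t u; elim/tensor_ind: s => [|s s' IH IH'|a b].
- by rewrite !tensor_mul0l addr0.
- by rewrite !(tensor_mulDl s s') IH IH' addrACA.
- rewrite tensor_mul.unlock !tensor_liftE //.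
  by have := tensor_lift_linear (inner_bilinear a b) 1 t u; rewrite !scale1r.
Qed.

Lemma tensor_mul0r t : tensor_mul t 0 = 0.
Proof. by apply: (addrI (tensor_mul t 0)); rewrite -tensor_mulDr !addr0. Qed.

Lemma tensor_mulA : associative tensor_mul.
Proof.
move=> s t u; elim/tensor_ind: s => [|s s' IH IH'|a b].
- by rewrite !tensor_mul0l.
- by rewrite !(tensor_mulDl s s') IH IH' tensor_mulDl.
elim/tensor_ind: t => [|t t' IH IH'|c d].
- by rewrite !(tensor_mul0l, tensor_mul0r).
- by rewrite (tensor_mulDl t t') !(tensor_mulDr (a *t b)) tensor_mulDl IH IH'.
elim/tensor_ind: u => [|u u' IH IH'|e f].
- by rewrite !tensor_mul0r.
- by rewrite !(tensor_mulDr _ u u') (tensor_mulDr (a *t b)) IH IH'.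
by rewrite !tensor_mulE !mulrA.
Qed.

Lemma tensor_mul1l : left_id tensor_one tensor_mul.
Proof.
elim/tensor_ind => [|s t IHs IHt|a b]; first exact: tensor_mul0r.
- by rewrite tensor_mulDr IHs IHt.
- by rewrite tensor_mulE !mul1r.
Qed.

Lemma tensor_mul1r : right_id tensor_one tensor_mul.
Proof.
elim/tensor_ind => [|s t IHs IHt|a b]; first exact: tensor_mul0l.
- by rewrite tensor_mulDl IHs IHt.
- by rewrite tensor_mulE !mulr1.
Qed.

HB.instance Definition _ := GRing.Zmodule_isPzRing.Build (tensor A B)
  tensor_mulA tensor_mul1l tensor_mul1r tensor_mulDl tensor_mulDr.

End TensorAlgebra.

Section Bialgebra.
Variables (k : comNzRingType) (H : algType k).
Variables (Delta : H -> tensor H H) (eps : H -> k).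

Record is_bialgebra : Prop := IsBialgebra {
  comul_linear : linear Delta;
  comul_multiplicative : monoid_morphism Delta;
  counit_linear : scalar eps;
  counit_multiplicative : monoid_morphism eps;
  coassociative : forall h,
    tensor_assoc (tensor_map Delta id (Delta h)) = tensor_map id Delta (Delta h);
  counit_left : forall h, tensor_lift (fun a b => eps a *: b) (Delta h) = h;
  counit_right : forall h, tensor_lift (fun a b => eps b *: a) (Delta h) = h
}.

Definition is_antipode (S : H -> H) : Prop :=
  [/\ linear S,
      forall h, tensor_lift (fun a b => S a * b) (Delta h) = (eps h)%:A &
      forall h, tensor_lift (fun a b => a * S b) (Delta h) = (eps h)%:A].

Definition is_hopf_algebra : Prop :=
  is_bialgebra /\ exists S, is_antipode S.

Definition is_primitive (h : H) : Prop := Delta h = h *t 1 + 1 *t h.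

(* [A n h] reads: h is homogeneous of degree n. *)
Record is_connected_graded_bialgebra (A : nat -> H -> Prop) : Prop :=
  IsConnectedGradedBialgebra {
    graded_bialgebra : is_bialgebra;
    graded0 : forall n, A n 0;
    gradedP : forall n a x y, A n x -> A n y -> A n (a *: x + y);
    graded_span : forall h, exists N (c : nat -> H),
      (forall n, A n (c n)) /\ h = \sum_(n < N) c n;
    graded_direct : forall N (c : nat -> H),
      (forall n, A n (c n)) -> \sum_(n < N) c n = 0 ->
      forall n, (n < N)%N -> c n = 0;
    graded1 : A 0 1;
    gradedM : forall p q x y, A p x -> A q y -> A (p + q)%N (x * y);
    graded_comul : forall n h, A n h -> exists s : seq (H * H),
      Delta h = \sum_(ab <- s) ab.1 *t ab.2 /\
      (forall ab, ab \in s ->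
         exists p q, [/\ (p + q)%N = n, A p ab.1 & A q ab.2]);
    graded_counit : forall n h, (0 < n)%N -> A n h -> eps h = 0;
    graded_connected : forall h, A 0 h -> exists c, h = c%:A
  }.

End Bialgebra.

Section OperatedBialgebra.
Variables (k : comNzRingType) (Omega : Type).

Definition is_cocycle_operators (H : algType k) (Delta : H -> tensor H H)
    (P : Omega -> H -> H) : Prop :=
  forall w, linear (P w) /\
    forall h, Delta (P w h) = P w h *t 1 + tensor_map id (P w) (Delta h).

Definition is_cocycle_bialgebra (H : algType k) (Delta : H -> tensor H H)
    (eps : H -> k) (P : Omega -> H -> H) : Prop :=
  is_bialgebra Delta eps /\ is_cocycle_operators Delta P.

Definition is_cocycle_hopf_algebra (H : algType k) (Delta : H -> tensor H H)
    (eps : H -> k) (P : Omega -> H -> H) : Prop :=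
  is_hopf_algebra Delta eps /\ is_cocycle_operators Delta P.

Record is_operated_bialgebra_hom (H H' : algType k)
    (Delta : H -> tensor H H) (eps : H -> k) (P : Omega -> H -> H)
    (Delta' : H' -> tensor H' H') (eps' : H' -> k) (P' : Omega -> H' -> H')
    (phi : H -> H') : Prop := IsOperatedBialgebraHom {
  hom_linear : linear phi;
  hom_multiplicative : monoid_morphism phi;
  hom_comul : forall h, Delta' (phi h) = tensor_map phi phi (Delta h);
  hom_counit : forall h, eps' (phi h) = eps h;
  hom_operators : forall w h, phi (P w h) = P' w (phi h)
}.

Definition operated_class : Type :=
  forall H : algType k,
    (H -> tensor H H) -> (H -> k) -> (Omega -> H -> H) -> Prop.

Definition is_free_in (C : operated_class) (X : Type) (HX : algType k)
    (Delta : HX -> tensor HX HX) (eps : HX -> k) (P : Omega -> HX -> HX)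
    (j : X -> HX) : Prop :=
  C HX Delta eps P /\
  forall (H : algType k) (Delta' : H -> tensor H H) (eps' : H -> k)
         (P' : Omega -> H -> H) (f : X -> H),
    C H Delta' eps' P' ->
    (forall x, is_primitive Delta' (f x)) ->
    exists! phi : HX -> H,
      is_operated_bialgebra_hom Delta eps P Delta' eps' P' phi /\
      (forall x, phi (j x) = f x).

Definition is_free_cocycle_bialgebra := is_free_in is_cocycle_bialgebra.

Definition is_free_cocycle_hopf_algebra := is_free_in is_cocycle_hopf_algebra.

End OperatedBialgebra.

(* Planar rooted trees with internal vertices decorated by Omega and leaves   *)
(* decorated by X (Leaf x) or by Omega (Node w [::]). The disjointness of X   *)
(* and Omega is that of the two constructors.                                 *)
Inductive tree (X Omega : Type) : Type :=
| Leaf of X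
| Node of Omega & seq (tree X Omega).

Arguments Leaf {X Omega} x.
Arguments Node {X Omega} w F.

Definition forest (X Omega : Type) : Type := seq (tree X Omega).

HB.instance Definition _ X Omega := gen_eqMixin (tree X Omega).
HB.instance Definition _ X Omega := gen_choiceMixin (tree X Omega).
HB.instance Definition _ X Omega := Choice.on (forest X Omega).

Section Forests.
Variables (X Omega : Type).

Lemma forest_unit (F G : forest X Omega) :
  F ++ G = [::] -> F = [::] /\ G = [::].
Proof. by case: F. Qed.

HB.instance Definition _ := Choice_isMonomialDef.Build (forest X Omega)
  (@catA _) (@cat0s _) (@cats0 _) forest_unit.

Fixpoint tree_degree (t : tree X Omega) : nat :=
  match t with
  | Leaf _ => 1
  | Node _ F => (sumn (map tree_degree F)).+1
  end.

Definition forest_degree (F : forest X Omega) : nat :=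
  sumn (map tree_degree F).

(* A set of vertices of a forest F is encoded by attaching a boolean to each  *)
(* vertex; [markings F] lists each of the resulting marked forests once.      *)
Definition marked_tree : Type := tree (bool * X) (bool * Omega).

Fixpoint tree_markings (t : tree X Omega) : seq marked_tree :=
  match t with
  | Leaf x => [:: Leaf (true, x); Leaf (false, x)]
  | Node w F =>
      let Ms := foldr (fun s Ms => [seq m :: M | m <- tree_markings s, M <- Ms])
                      [:: [::]] F in
      [seq Node (true, w) M | M <- Ms] ++ [seq Node (false, w) M | M <- Ms]
  end.

Definition markings (F : forest X Omega) : seq (seq marked_tree) :=
  foldr (fun s Ms => [seq m :: M | m <- tree_markings s, M <- Ms]) [:: [::]] F.

Definition root_mark (m : marked_tree) : bool :=
  match m with
  | Leaf (b, _) => b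
  | Node (b, _) _ => b
  end.

(* The children of a marked vertex are marked; hence so are all its descendants. *)
Fixpoint descendant_closed (m : marked_tree) : bool :=
  match m with
  | Leaf _ => true
  | Node (b, _) M =>
      all (fun c => (b ==> root_mark c) && descendant_closed c) M
  end.

(* The forest formed by the vertices with mark b and the edges between them.  *)
Fixpoint tree_part (b : bool) (m : marked_tree) : forest X Omega :=
  match m with
  | Leaf (c, x) => if c == b then [:: Leaf x] else [::]
  | Node (c, w) M =>
      let F := flatten (map (tree_part b) M) in
      if c == b then [:: Node w F] else F
  end.

Definition part (b : bool) (M : seq marked_tree) : forest X Omega :=
  flatten (map (tree_part b) M).

End Forests.

Section HRT.
Variables (k : comNzRingType) (X Omega : Type).

(* The product of {malg k[forest X Omega]} extends the concatenation of forests. *)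
Definition HRT : Type := {malg k[forest X Omega]}.

HB.instance Definition _ := GRing.Lalgebra.on HRT.

Lemma HRT_scaleAr (a : k) (x y : HRT) : a *: (x * y) = x * (a *: y).
Proof.
rewrite [RHS](malgMEw (fsubset_refl _) (msuppZ_le a y)) malgME.
rewrite scaler_sumr; apply: eq_bigr => F _.
rewrite scaler_sumr; apply: eq_bigr => G _; apply/malgP => m.
by rewrite !mcoeffZ !mcoeffU mulrnAr mulrCA.
Qed.

HB.instance Definition _ := GRing.Lalgebra_isAlgebra.Build k HRT HRT_scaleAr.

Definition of_forest (F : forest X Omega) : HRT := << F >>.

Definition jRT (x : X) : HRT := of_forest [:: Leaf x].

(* A subforest G of F is a descendant-closed marking M of F: G = part true M   *)
(* and F / G = part false M.                                                  *)
Definition forest_comul (F : forest X Omega) : tensor HRT HRT :=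
  \sum_(M <- markings F | all (@descendant_closed X Omega) M)
     of_forest (part true M) *t of_forest (part false M).

Definition DeltaRT : HRT -> tensor HRT HRT := linear_ext forest_comul.

Definition epsRT (h : HRT) : k := h@_([::] : forest X Omega).

Definition BplusRT (w : Omega) : HRT -> HRT :=
  linear_ext (fun F : forest X Omega => of_forest [:: Node w F]).

Definition homogeneousRT (n : nat) (h : HRT) : Prop :=
  forall F : forest X Omega, F \in msupp h -> forest_degree F = n.

End HRT.

Arguments jRT k {X} Omega x.
Arguments DeltaRT {k X Omega} _.
Arguments epsRT {k X Omega} h.
Arguments BplusRT {k X Omega} w _.
Arguments homogeneousRT {k X Omega} n h.

(* Main.v *)
Require Import Defs.
From mathcomp Require Import all_boot all_algebra.
From mathcomp Require Import finmap boolp monalg.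

Set Implicit Arguments.
Unset Strict Implicit.
Unset Printing Implicit Defensive.

Import GRing.Theory.
Local Open Scope ring_scope.

(** The forests form the free Omega-operated algebra on X, and the coproduct is
    compatible with every ingredient of that structure. This gives all the
    claims except the existence of an antipode.

    The algebra is generated, as an algebra closed under the grafting operators
    and linear combinations, by the one-vertex trees decorated by X: this is the
    induction principle [HRT_ind]. The sum over subforests is multiplicative
    because a subforest of F ++ G is a pair of subforests, and it satisfies the
    cocycle identity because a subforest of a tree either contains the root, and
    is then the whole tree, or is a subforest of the forest below the root
    ([DeltaRT_morphism], [DeltaRT_cocycle]). Hence every bialgebra axiom may be
    checked by showing that the set of elements satisfying it is closed under
    products, contains the primitive generators, and is stable under an operator
    that satisfies the cocycle identity ([coassoc_at_cocycle] and its analogues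
    for the counit).

    For the universal property, a target operated algebra and a map from X give
    a unique morphism of operated algebras, by recursion on trees
    ([HRT_eval]). That it respects the coproducts is again an instance of
    [HRT_ind]: both sides are multiplicative, they agree on primitive elements,
    and both satisfy the same recursion under the operators. That it respects
    the counits uses that in any bialgebra the counit kills the primitive
    elements and the image of a cocycle operator ([counit_cocycle]).

    The antipode is a convolution inverse of the identity, given by the
    geometric series in J = e - id, where e h = eps h . 1 is the unit of the
    convolution. In a connected graded bialgebra J kills degree 0, so the n-th
    convolution power of J kills all degrees below n and the series is locally
    finite ([connected_graded_antipode]). *)

(** * Linear maps on tensor products *)

Section LinearFunctions.
Variable k : comNzRingType.
Implicit Types U V W : lmodType k.

Lemma linD U V (f : U -> V) : linear f -> {morph f : x y / x + y}.
Proof. by move=> lf x y; have := lf 1 x y; rewrite !scale1r. Qed.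

Lemma lin0 U V (f : U -> V) : linear f -> f 0 = 0.
Proof. by move=> lf; apply: (addrI (f 0)); rewrite -(linD lf) !addr0. Qed.

Lemma linZ U V (f : U -> V) a : linear f -> {morph f : x / a *: x}.
Proof. by move=> lf x; have := lf a x 0; rewrite (lin0 lf) !addr0. Qed.

Lemma lin_sum U V (f : U -> V) (I : Type) (r : seq I) (P : pred I)
    (F : I -> U) :
  linear f -> f (\sum_(i <- r | P i) F i) = \sum_(i <- r | P i) f (F i).
Proof. by move=> lf; apply: (big_morph f (linD lf) (lin0 lf)). Qed.

Lemma lin_comp U V W (f : V -> W) (g : U -> V) :
  linear f -> linear g -> linear (f \o g).
Proof. by move=> lf lg a x y /=; rewrite lg lf. Qed.

Lemma lin_id U : linear (@id U).
Proof. by []. Qed.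

Lemma lin_add U V (f g : U -> V) :
  linear f -> linear g -> linear (fun x => f x + g x).
Proof. by move=> lf lg a x y; rewrite lf lg scalerDr addrACA. Qed.

(** Pure tensors span; nearly every tensor identity below is reduced to them
    in this way, one tensor variable at a time. *)
Lemma tensor_eq V W U (f g : tensor V W -> U) : linear f -> linear g ->
  (forall v w, f (v *t w) = g (v *t w)) -> f =1 g.
Proof.
move=> lf lg fg; elim/tensor_ind=> [|s t IHs IHt|]; last exact: fg.
  by rewrite !lin0.
by rewrite !linD // IHs IHt.
Qed.

Lemma tens_linl V W (w : W) : linear (fun v : V => v *t w).
Proof. by move=> a x y; rewrite tensDl tensZl. Qed.

Lemma tens_linr V W (v : V) : linear (fun w : W => v *t w).
Proof. by move=> a x y; rewrite tensDr tensZr. Qed.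

Lemma bilinear_comp (V W V' W' U : lmodType k) (b : V' -> W' -> U)
    (f : V -> V') (g : W -> W') : bilinear_map b -> linear f -> linear g ->
  bilinear_map (fun v w => b (f v) (g w)).
Proof.
move=> [bl br] lf lg; split=> [w|v]; first exact: lin_comp (bl (g w)) lf.
exact: lin_comp (br (f v)) lg.
Qed.

Lemma bilinear_tens V W : bilinear_map (fun (v : V) (w : W) => v *t w).
Proof. by split=> [w|v]; [exact: tens_linl | exact: tens_linr]. Qed.

Lemma bilinear_scale V : bilinear_map (fun (a : k^o) (v : V) => a *: v).
Proof.
split=> [v|a] c x y; first by rewrite scalerDl scalerA.
by rewrite scalerDr !scalerA mulrC.
Qed.

Lemma bilinear_mul (A : algType k) : bilinear_map (fun a b : A => a * b).
Proof.
split=> [b|a] c x y; first by rewrite mulrDl scalerAl.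
by rewrite mulrDr scalerAr.
Qed.

Section Map.
Variables (V W V' W' : lmodType k) (f : V -> V') (g : W -> W').
Hypotheses (lf : linear f) (lg : linear g).

Let bil : bilinear_map (fun v w => f v *t g w).
Proof. exact: bilinear_comp (bilinear_tens _ _) lf lg. Qed.

Lemma tensor_mapE v w : tensor_map f g (v *t w) = f v *t g w.
Proof. exact: tensor_liftE. Qed.

Lemma tensor_map_lin : linear (tensor_map f g).
Proof. exact: tensor_lift_linear. Qed.

End Map.

Lemma bilinear_assoc_inner U V W (w : W) :
  bilinear_map (fun (u : U) (v : V) => u *t (v *t w)).
Proof.
exact: (@bilinear_comp U V U (tensor V W) _ (fun u t => u *t t) id
  (fun v => v *t w) (bilinear_tens _ _) (@lin_id _) (tens_linl _)).
Qed.

Arguments bilinear_assoc_inner {U V W} w.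

Lemma bilinear_assoc U V W : bilinear_map (fun (t : tensor U V) (w : W) =>
  tensor_lift (fun u v => u *t (v *t w)) t).
Proof.
split=> [w|t]; first exact: (tensor_lift_linear (bilinear_assoc_inner w)).
move=> a x y; elim/tensor_ind: t => [|s t IHs IHt|u v].
- rewrite !(lin0 (tensor_lift_linear (bilinear_assoc_inner _))).
  by rewrite scaler0 addr0.
- rewrite !(linD (tensor_lift_linear (bilinear_assoc_inner _))) IHs IHt.
  by rewrite scalerDr addrACA.
rewrite !(tensor_liftE _ _ (bilinear_assoc_inner _)).
by rewrite !tens_linr.
Qed.

Lemma tensor_assocE U V W (u : U) (v : V) (w : W) :
  tensor_assoc (u *t v *t w) = u *t (v *t w).
Proof.
rewrite /tensor_assoc (tensor_liftE _ _ (bilinear_assoc U V W)).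
by rewrite (tensor_liftE _ _ (bilinear_assoc_inner _)).
Qed.

Lemma tensor_assoc_lin U V W : linear (@tensor_assoc k U V W).
Proof. exact: tensor_lift_linear (bilinear_assoc U V W). Qed.

End LinearFunctions.

Section TensorProducts.
Variable k : comNzRingType.

Lemma tens_mul (A B : algType k) (a c : A) (b d : B) :
  (a *t b) * (c *t d) = (a * c) *t (b * d).
Proof. exact: tensor_mulE. Qed.

Lemma tensor_bilinear_mul (A B : algType k) :
  bilinear_map (fun s t : tensor A B => s * t).
Proof.
suff Z (a : k) (s t : tensor A B) :
    (a *: s) * t = a *: (s * t) /\ s * (a *: t) = a *: (s * t).
  split=> [t|s] a x y; first by rewrite mulrDl (Z a x t).1.
  by rewrite mulrDr (Z a s x).2.
elim/tensor_ind: s => [|s s' [IH1 IH2] [IH3 IH4]|u v].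
- by rewrite scaler0 !mul0r scaler0.
- by rewrite scalerDr !mulrDl scalerDr IH1 IH2 IH3 IH4.
elim/tensor_ind: t => [|t t' [IH1 IH2] [IH3 IH4]|u' v'].
- by rewrite scaler0 !mulr0 scaler0.
- by rewrite scalerDr !mulrDr scalerDr IH1 IH2 IH3 IH4.
rewrite -!tensZl !tens_mul -!tensZl scalerAl.
by split; rewrite -?scalerAr -?scalerAl.
Qed.

Lemma tensor_map_mul (A B A' B' : algType k) (f : A -> A') (g : B -> B') :
  linear f -> linear g -> monoid_morphism f -> monoid_morphism g ->
  {morph tensor_map f g : s t / s * t}.
Proof.
move=> lf lg [_ fM] [_ gM] s t; have lfg := tensor_map_lin lf lg.
elim/tensor_ind: s => [|s s' IH IH'|a b].
- by rewrite mul0r (lin0 lfg) mul0r.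
- by rewrite mulrDl !(linD lfg) IH IH' mulrDl.
elim/tensor_ind: t => [|t t' IH IH'|c d].
- by rewrite mulr0 (lin0 lfg) mulr0.
- by rewrite mulrDr !(linD lfg) IH IH' mulrDr.
by rewrite tens_mul !tensor_mapE // tens_mul fM gM.
Qed.

(** Used with b a counit acting on one factor, whose values on pure tensors
    multiply factor by factor. *)
Lemma tensor_lift_mul (A B : algType k) (C : algType k) (b : A -> B -> C) :
  bilinear_map b ->
  (forall a a' c c', b (a * a') (c * c') = b a c * b a' c') ->
  {morph tensor_lift b : s t / s * t}.
Proof.
move=> bb bM s t; have lb := tensor_lift_linear bb.
elim/tensor_ind: s => [|s s' IH IH'|a c].
- by rewrite mul0r (lin0 lb) mul0r.
- by rewrite mulrDl !(linD lb) IH IH' mulrDl.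
elim/tensor_ind: t => [|t t' IH IH'|a' c'].
- by rewrite mulr0 (lin0 lb) mulr0.
- by rewrite mulrDr !(linD lb) IH IH' mulrDr.
by rewrite tens_mul !tensor_liftE.
Qed.

(** The product of A (x) (B (x) C), the algebra in which coassociativity
    compares its two sides. *)
Section Triple.
Variables (A B C : algType k).

Definition triple_mul (s t : tensor A (tensor B C)) : tensor A (tensor B C) :=
  tensor_lift (fun (a : A) (u : tensor B C) =>
    tensor_map ( *%R a) ( *%R u) t) s.

Let lmulA (a : A) : linear ( *%R a).
Proof. exact: (bilinear_mul A).2. Qed.

Let lmulT (u : tensor B C) : linear ( *%R u).
Proof. exact: (tensor_bilinear_mul B C).2. Qed.

Let bil t : bilinear_map (fun (a : A) (u : tensor B C) =>
  tensor_map ( *%R a) ( *%R u) t).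
Proof.
split=> [u|a] c x y; elim/tensor_ind: t => [|t t' IH IH'|p q].
all: rewrite ?(lin0 (tensor_map_lin (lmulA _) (lmulT _))) ?scaler0 ?addr0 //.
all: try by rewrite !(linD (tensor_map_lin (lmulA _) (lmulT _)))
  IH IH' scalerDr addrACA.
  by rewrite !tensor_mapE // (bilinear_mul A).1 tens_linl.
by rewrite !tensor_mapE // (tensor_bilinear_mul B C).1 tens_linr.
Qed.

Lemma triple_mulE a u c v :
  triple_mul (a *t u) (c *t v) = (a * c) *t (u * v).
Proof. by rewrite /triple_mul (tensor_liftE _ _ (bil _)) tensor_mapE. Qed.

Lemma triple_mul_bilinear : bilinear_map triple_mul.
Proof.
split=> [t|s]; first exact: tensor_lift_linear.
move=> c x y; elim/tensor_ind: s => [|s s' IH IH'|a u].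
- by rewrite /triple_mul !(lin0 (tensor_lift_linear (bil _))) scaler0 addr0.
- rewrite /triple_mul !(linD (tensor_lift_linear (bil _))).
  by rewrite -!/(triple_mul _ _) IH IH' scalerDr addrACA.
rewrite /triple_mul !(tensor_liftE _ _ (bil _)).
exact: tensor_map_lin.
Qed.

End Triple.

End TensorProducts.

(** * The algebra of forests *)

Section ForestInduction.
Variables X Omega : Type.

(** Peels off the first tree; the forest below its root and the remaining
    forest are both available as induction hypotheses, so no separate induction
    on trees is needed afterwards. *)
Lemma forest_ind (P : forest X Omega -> Prop) :
    P [::] ->
    (forall x F, P F -> P (Leaf x :: F)) ->
    (forall w G F, P G -> P F -> P (Node w G :: F)) ->
  forall F, P F.
Proof.
move=> P0 PL PN.
(* Nested recursion: the children of t are added one by one to a forest. *)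
have step (t : tree X Omega) : forall F, P F -> P (t :: F).
  move: t; fix IHt 1 => -[x|w G] F PF; first exact: PL.
  by apply: PN => //; elim: G => [//|t G IHG]; apply: IHt.
by elim=> [//|t F]; apply: step.
Qed.

End ForestInduction.

Section ForestAlgebra.
Variables (k : comNzRingType) (X Omega : Type).
Local Notation H := (HRT k X Omega).
Local Notation of_forest := (@of_forest k X Omega).

Lemma of_forest_nil : of_forest [::] = 1.
Proof. by []. Qed.

Lemma of_forest_cat F G : of_forest (F ++ G) = of_forest F * of_forest G.
Proof.
by rewrite /of_forest [RHS]malgM_def fgmulUU mulr1.
Qed.

Lemma of_forest_cons t F : of_forest (t :: F) = of_forest [:: t] * of_forest F.
Proof. exact: (of_forest_cat [:: t]). Qed.

Lemma forest_expansion (h : H) : h = \sum_(F <- msupp h) h@_F *: of_forest F.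
Proof.
rewrite [LHS]monalgE; apply: eq_bigr => F _; apply/malgP=> G.
by rewrite mcoeffZ !mcoeffU mulrnAr mulr1.
Qed.

Lemma HRT_lin_eq (V : lmodType k) (f g : H -> V) : linear f -> linear g ->
  (forall F, f (of_forest F) = g (of_forest F)) -> f =1 g.
Proof.
move=> lf lg fg h; rewrite (forest_expansion h) !lin_sum //.
by apply: eq_bigr => F _; rewrite (linZ _ lf) (linZ _ lg) fg.
Qed.

Lemma BplusRT_lin w : linear (@BplusRT k X Omega w).
Proof. exact: linearP. Qed.

Lemma BplusRT_of_forest w F :
  BplusRT w (of_forest F) = of_forest [:: Node w F].
Proof. exact: linear_extU. Qed.

(** Forests are products of trees, a tree is either a leaf decorated by X or a
    grafting of a smaller forest, and the empty forest is the unit: so nothing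
    smaller is closed under all the operations. *)
Lemma HRT_ind (P : H -> Prop) :
    (forall a x y, P x -> P y -> P (a *: x + y)) ->
    P 1 -> (forall x y, P x -> P y -> P (x * y)) ->
    (forall x, P (jRT k Omega x)) ->
    (forall w h, P h -> P (BplusRT w h)) ->
  forall h, P h.
Proof.
move=> Plin P1 PM Pj PB h.
have P0 : P 0 by rewrite -(addNr 1) -scaleN1r; apply: Plin.
have PD x y : P x -> P y -> P (x + y).
  by move=> Px Py; rewrite -[x]scale1r; apply: Plin.
have PF F : P (of_forest F).
  elim/forest_ind: F => [//|x F IH|w G F IHG IH]; rewrite of_forest_cons;
    apply: PM => //; first exact: Pj.
  by rewrite -BplusRT_of_forest; apply: PB.
rewrite (forest_expansion h); apply: big_ind => // F _.
by rewrite -[_ *: _]addr0; apply: Plin.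
Qed.

End ForestAlgebra.

Arguments BplusRT_lin {k X Omega} w.

(** * The coproduct of forests *)

Section Coproduct.
Variables (k : comNzRingType) (X Omega : Type).
Local Notation H := (HRT k X Omega).
Local Notation of_forest := (@of_forest k X Omega).
Local Notation DeltaRT := (@DeltaRT k X Omega).

Lemma DeltaRT_lin : linear DeltaRT.
Proof. exact: linearP. Qed.

Lemma DeltaRT_of_forest F : DeltaRT (of_forest F) = forest_comul k F.
Proof. exact: linear_extU. Qed.

(** Marking a forest amounts to marking its first tree and the remaining
    forest independently, so sums over markings factor. *)
Lemma sum_markings_cons (V : nmodType) t (F : forest X Omega)
    (p : pred (marked_tree X Omega)) (f : seq (marked_tree X Omega) -> V) :
  \sum_(M <- markings (t :: F) | all p M) f M =
  \sum_(m <- tree_markings t | p m) \sum_(M <- markings F | all p M) f (m :: M).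
Proof.
rewrite /= big_mkcond big_allpairs_dep [RHS]big_mkcond /=.
apply: eq_bigr => m _; case: (p m) => /=; last by rewrite big1.
by rewrite [RHS]big_mkcond.
Qed.

Definition tree_comul (t : tree X Omega) : tensor H H :=
  \sum_(m <- tree_markings t | descendant_closed m)
     of_forest (tree_part true m) *t of_forest (tree_part false m).

Lemma forest_comul_nil : @forest_comul k X Omega [::] = 1.
Proof. by rewrite /forest_comul /= big_mkcond big_seq1. Qed.

Lemma forest_comul_cons t F :
  forest_comul k (t :: F) = tree_comul t * forest_comul k F.
Proof.
rewrite /forest_comul sum_markings_cons /tree_comul mulr_suml.
apply: eq_bigr => m _; rewrite mulr_sumr; apply: eq_bigr => M _.
by rewrite tens_mul -!of_forest_cat.
Qed.

Lemma forest_comul_cat F G :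
  @forest_comul k X Omega (F ++ G) = forest_comul k F * forest_comul k G.
Proof.
elim: F => [|t F IH]; first by rewrite forest_comul_nil mul1r.
by rewrite cat_cons !forest_comul_cons IH mulrA.
Qed.

Lemma DeltaRT_morphism : monoid_morphism DeltaRT.
Proof.
split=> [|x y].
  by rewrite -[1]of_forest_nil DeltaRT_of_forest forest_comul_nil.
have [Hl Hr] := bilinear_mul H.
have [Tl Tr] := tensor_bilinear_mul H H.
move: x; apply: HRT_lin_eq.
- exact: lin_comp DeltaRT_lin (Hl y).
- exact: lin_comp (Tl _) DeltaRT_lin.
move=> F; move: y; apply: HRT_lin_eq.
- exact: lin_comp DeltaRT_lin (Hr _).
- exact: lin_comp (Tr _) DeltaRT_lin.
by move=> G; rewrite -of_forest_cat !DeltaRT_of_forest forest_comul_cat.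
Qed.

Lemma forest_comul1 t : forest_comul k [:: t] = tree_comul t.
Proof. by rewrite forest_comul_cons forest_comul_nil mulr1. Qed.

Lemma DeltaRT_j x : is_primitive DeltaRT (jRT k Omega x).
Proof.
rewrite /is_primitive DeltaRT_of_forest forest_comul1 /tree_comul /=.
by rewrite !big_cons big_nil /= addr0.
Qed.

(** A forest has a single descendant-closed marking in which all roots are
    marked: the one with G = F and F / G = 1. The function f is arbitrary so
    that the induction can absorb the trees already treated into it. *)
Lemma sum_full_marking (V : nmodType)
    (f : forest X Omega -> forest X Omega -> V) (F : forest X Omega) :
  \sum_(M <- markings F | all (fun m => root_mark m && descendant_closed m) M)
     f (part true M) (part false M) = f F [::].
Proof.
elim/forest_ind: F f => [|x F IH|w G F IHG IHF] f.
- by rewrite big_mkcond big_seq1.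
- rewrite sum_markings_cons /= big_mkcond !big_cons big_nil /= addr0.
  by rewrite addr0; apply: (IH (fun A B => f (_ :: A) B)).
rewrite sum_markings_cons /= big_cat /= !big_map /=.
rewrite [X in _ + X]big_pred0 // addr0.
rewrite (IHG (fun A B =>
  \sum_(M <- markings F |
        all (fun m => root_mark m && descendant_closed m) M)
   f (Node w A :: part true M) (B ++ part false M))).
exact: (IHF (fun A B => f (Node w G :: A) B)).
Qed.

(** The first term is the marking that contains the root, hence everything;
    the other markings leave the root in the quotient and mark the forest below
    it freely. *)
Lemma tree_comul_node w F : tree_comul (Node w F) =
  of_forest [:: Node w F] *t 1 + tensor_map id (BplusRT w) (forest_comul k F).
Proof.
rewrite /tree_comul /= big_cat /= !big_map /=; congr (_ + _).
  exact: (sum_full_marking (fun A B => of_forest [:: Node w A] *t of_forest B)).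
rewrite (lin_sum _ _ _ (tensor_map_lin (@lin_id _ _) (BplusRT_lin w))).
apply: eq_bigr => M _.
by rewrite (tensor_mapE (@lin_id _ _) (BplusRT_lin w)) BplusRT_of_forest.
Qed.

Lemma DeltaRT_cocycle : is_cocycle_operators DeltaRT (@BplusRT k X Omega).
Proof.
move=> w; split; first exact: BplusRT_lin.
have lm := tensor_map_lin (@lin_id k H) (@BplusRT_lin k X Omega w).
apply: HRT_lin_eq.
- exact: lin_comp DeltaRT_lin (BplusRT_lin w).
- apply: lin_add; last exact: lin_comp lm DeltaRT_lin.
  exact: lin_comp (tens_linl _) (BplusRT_lin w).
move=> F; rewrite BplusRT_of_forest !DeltaRT_of_forest forest_comul1.
exact: tree_comul_node.
Qed.

End Coproduct.

(** * Coassociativity and cocycle operators *)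

Section TripleCoproduct.
Variables (k : comNzRingType) (H : algType k) (Delta : H -> tensor H H).
Hypotheses (lD : linear Delta) (mD : monoid_morphism Delta).

Local Notation triple_mul := (@triple_mul k H H H).

(* The two ways to apply the coproduct a second time. *)
Let T1 (s : tensor H H) := tensor_assoc (tensor_map Delta id s).
Let T2 (s : tensor H H) : tensor H (tensor H H) := tensor_map id Delta s.

Let lmap : linear (tensor_map Delta (@id H)).
Proof. exact: tensor_map_lin. Qed.

Lemma coassoc_left_lin : linear T1.
Proof. exact: lin_comp (@tensor_assoc_lin _ H H H) lmap. Qed.

Lemma coassoc_right_lin : linear T2.
Proof. exact: tensor_map_lin. Qed.

Let T1E a b : T1 (a *t b) = tensor_assoc (Delta a *t b).
Proof. by rewrite /T1 tensor_mapE. Qed.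

Let T2E a b : T2 (a *t b) = a *t Delta b.
Proof. by rewrite /T2 tensor_mapE. Qed.

Let assoc_lin (b : H) : linear (fun u : tensor H H => tensor_assoc (u *t b)).
Proof. exact: lin_comp (@tensor_assoc_lin _ H H H) (tens_linl b). Qed.

Let assoc_mul (u v : tensor H H) b d :
  tensor_assoc ((u * v) *t (b * d)) =
  triple_mul (tensor_assoc (u *t b)) (tensor_assoc (v *t d)).
Proof.
have [Ml Mr] := @triple_mul_bilinear k H H H.
have [Tl Tr] := tensor_bilinear_mul H H.
move: u; apply: tensor_eq.
- exact: lin_comp (assoc_lin _) (Tl v).
- exact: lin_comp (Ml _) (assoc_lin b).
move=> a1 a2; move: v; apply: tensor_eq.
- exact: lin_comp (assoc_lin _) (Tr _).
- exact: lin_comp (Mr _) (assoc_lin d).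
by move=> c1 c2; rewrite tens_mul !tensor_assocE triple_mulE tens_mul.
Qed.

Lemma coassoc_left_mul s t : T1 (s * t) = triple_mul (T1 s) (T1 t).
Proof.
have [Ml Mr] := @triple_mul_bilinear k H H H.
have [Tl Tr] := tensor_bilinear_mul H H.
have l1 := coassoc_left_lin.
move: s; apply: tensor_eq.
- exact: lin_comp l1 (Tl t).
- exact: lin_comp (Ml _) l1.
move=> a b; move: t; apply: tensor_eq.
- exact: lin_comp l1 (Tr _).
- exact: lin_comp (Mr _) l1.
by move=> c d; rewrite tens_mul !T1E -assoc_mul mD.2.
Qed.

Lemma coassoc_right_mul s t : T2 (s * t) = triple_mul (T2 s) (T2 t).
Proof.
have [Ml Mr] := @triple_mul_bilinear k H H H.
have [Tl Tr] := tensor_bilinear_mul H H.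
have l2 := coassoc_right_lin.
move: s; apply: tensor_eq.
- exact: lin_comp l2 (Tl t).
- exact: lin_comp (Ml _) l2.
move=> a b; move: t; apply: tensor_eq.
- exact: lin_comp l2 (Tr _).
- exact: lin_comp (Mr _) l2.
by move=> c d; rewrite tens_mul !T2E triple_mulE mD.2.
Qed.

(** Coassociativity at one element, so that the elements where it holds can be
    shown to be stable under the operations of an operated algebra. *)
Definition coassoc_at h :=
  tensor_assoc (tensor_map Delta id (Delta h)) = tensor_map id Delta (Delta h).

Lemma coassoc_at_lin a x y :
  coassoc_at x -> coassoc_at y -> coassoc_at (a *: x + y).
Proof.
rewrite /coassoc_at -!/(T1 _) -!/(T2 _) => cx cy.
by rewrite lD coassoc_left_lin cx cy coassoc_right_lin.
Qed.

Lemma coassoc_at1 : coassoc_at 1.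
Proof.
rewrite /coassoc_at -!/(T1 _) -!/(T2 _) mD.1.
by rewrite T1E T2E !mD.1 tensor_assocE.
Qed.

Lemma coassoc_atM x y : coassoc_at x -> coassoc_at y -> coassoc_at (x * y).
Proof.
rewrite /coassoc_at -!/(T1 _) -!/(T2 _) => cx cy.
by rewrite mD.2 coassoc_left_mul cx cy coassoc_right_mul.
Qed.

Lemma coassoc_at_primitive x : is_primitive Delta x -> coassoc_at x.
Proof.
rewrite /is_primitive /coassoc_at -!/(T1 _) -!/(T2 _) => px.
rewrite px (linD coassoc_left_lin) (linD coassoc_right_lin) !T1E !T2E px mD.1.
rewrite tensDl tensDr (linD (@tensor_assoc_lin _ H H H)) !tensor_assocE.
by rewrite addrA.
Qed.

Variable P : H -> H.
Hypotheses (lP : linear P)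
  (DP : forall h, Delta (P h) = P h *t 1 + tensor_map id P (Delta h)).

Let lidP : linear (tensor_map (@id H) P).
Proof. exact: tensor_map_lin. Qed.

Let lidP2 : linear (tensor_map (@id H) (tensor_map (@id H) P)).
Proof. exact: tensor_map_lin. Qed.

Let P1 (b : H) : tensor H H := P b *t 1.

Let lP1 : linear P1.
Proof. exact: lin_comp (tens_linl _) lP. Qed.

Let lidP1 : linear (tensor_map (@id H) P1).
Proof. exact: tensor_map_lin. Qed.

Let assoc_P u b :
  tensor_assoc (u *t P b) =
  tensor_map (@id H) (tensor_map (@id H) P) (tensor_assoc (u *t b)).
Proof.
move: u; apply: tensor_eq.
- exact: assoc_lin.
- exact: lin_comp lidP2 (assoc_lin _).
by move=> a c; rewrite !tensor_assocE !tensor_mapE.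
Qed.

Let T1P (t : tensor H H) :
  T1 (tensor_map id P t) = tensor_map (@id H) (tensor_map (@id H) P) (T1 t).
Proof.
move: t; apply: tensor_eq.
- exact: lin_comp coassoc_left_lin lidP.
- exact: lin_comp lidP2 coassoc_left_lin.
by move=> a b; rewrite !tensor_mapE // !T1E assoc_P.
Qed.

Let T2P (t : tensor H H) : T2 (tensor_map id P t) =
  tensor_map (@id H) P1 t + tensor_map (@id H) (tensor_map (@id H) P) (T2 t).
Proof.
move: t; apply: tensor_eq.
- exact: lin_comp coassoc_right_lin lidP.
- by apply: lin_add => //; exact: lin_comp lidP2 coassoc_right_lin.
by move=> a b; rewrite !tensor_mapE // !T2E !tensor_mapE // DP tensDr.
Qed.

Let assoc_P1 (t : tensor H H) : tensor_assoc (tensor_map id P t *t (1 : H)) =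
  tensor_map (@id H) P1 t.
Proof.
move: t; apply: tensor_eq => //.
- exact: lin_comp (assoc_lin _) lidP.
by move=> a b; rewrite !tensor_mapE // tensor_assocE.
Qed.

(** Both iterated coproducts T satisfy the same recursion
    T(P h) = P h (x) 1 (x) 1 + (id (x) P1) (Delta h) + (id (x) id (x) P) T(h),
    where P1 b = P b (x) 1. *)
Lemma coassoc_at_cocycle h : coassoc_at h -> coassoc_at (P h).
Proof.
rewrite /coassoc_at -!/(T1 _) -!/(T2 _) => ch.
rewrite DP (linD coassoc_left_lin) (linD coassoc_right_lin) T1P T2P ch T1E T2E.
rewrite DP tensDl (linD (@tensor_assoc_lin _ H H H)) tensor_assocE assoc_P1.
by rewrite mD.1 addrA.
Qed.

End TripleCoproduct.

(** * Counits and cocycle operators *)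

Section Counit.
Variables (k : comNzRingType) (H : algType k) (eps : H -> k).
Hypotheses (leps : scalar eps) (meps : monoid_morphism eps).

Definition counit_mul_left : tensor H H -> H :=
  tensor_lift (fun a b => eps a *: b).

Definition counit_mul_right : tensor H H -> H :=
  tensor_lift (fun a b => eps b *: a).

Let bl : bilinear_map (fun a b : H => eps a *: b).
Proof.
exact: (@bilinear_comp k H H k^o H H _ eps id (bilinear_scale H) leps
  (@lin_id _ _)).
Qed.

Let br : bilinear_map (fun a b : H => eps b *: a).
Proof. by case: bl. Qed.

Lemma counit_mul_leftE a b : counit_mul_left (a *t b) = eps a *: b.
Proof. exact: tensor_liftE. Qed.

Lemma counit_mul_rightE a b : counit_mul_right (a *t b) = eps b *: a.
Proof. exact: tensor_liftE. Qed.

Lemma counit_mul_left_lin : linear counit_mul_left.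
Proof. exact: tensor_lift_linear. Qed.

Lemma counit_mul_right_lin : linear counit_mul_right.
Proof. exact: tensor_lift_linear. Qed.

Lemma counit_mul_leftM : {morph counit_mul_left : s t / s * t}.
Proof.
apply: tensor_lift_mul => // a a' c c'.
by rewrite meps.2 -scalerAl -scalerAr scalerA.
Qed.

Lemma counit_mul_rightM : {morph counit_mul_right : s t / s * t}.
Proof.
apply: tensor_lift_mul => // a a' c c'.
by rewrite meps.2 -scalerAl -scalerAr scalerA.
Qed.

Variable P : H -> H.
Hypotheses (lP : linear P).

Lemma counit_mul_leftP (t : tensor H H) :
  counit_mul_left (tensor_map id P t) = P (counit_mul_left t).
Proof.
have lidP := tensor_map_lin (@lin_id _ H) lP.
move: t; apply: tensor_eq.
- exact: lin_comp counit_mul_left_lin lidP.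
- exact: lin_comp lP counit_mul_left_lin.
by move=> a b; rewrite tensor_mapE // !counit_mul_leftE (linZ _ lP).
Qed.

Lemma counit_mul_rightP (t : tensor H H) : (forall h, eps (P h) = 0) ->
  counit_mul_right (tensor_map id P t) = 0.
Proof.
move=> eP; have lidP := tensor_map_lin (@lin_id _ H) lP.
have lr := counit_mul_right_lin.
elim/tensor_ind: t => [|s t IH IH'|a b].
- by rewrite (lin0 lidP) (lin0 lr).
- by rewrite (linD lidP) (linD lr) IH IH' addr0.
by rewrite tensor_mapE // counit_mul_rightE eP scale0r.
Qed.

End Counit.

Section CounitValues.
Variables (k : comNzRingType) (H : algType k).
Variables (Delta : H -> tensor H H) (eps : H -> k).
Hypothesis bH : is_bialgebra Delta eps.

(* Applying eps itself avoids any injectivity assumption on k -> H. *)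
Let eps_scalar0 c : c *: (1 : H) = 0 -> c = 0.
Proof.
move=> c0; have := congr1 eps c0.
have le : linear (eps : H -> k^o) := counit_linear bH.
rewrite (linZ c le) (lin0 le) (counit_multiplicative bH).1.
by rewrite /GRing.scale /= mulr1.
Qed.

(** Applying the counit to the left factor of x (x) 1 + 1 (x) x gives
    x = eps x . 1 + x. *)
Lemma counit_primitive x : is_primitive Delta x -> eps x = 0.
Proof.
move=> px; apply: eps_scalar0; apply: (addIr x); rewrite add0r.
have := counit_left bH x; rewrite px -/(counit_mul_left eps _).
rewrite (linD (counit_mul_left_lin (counit_linear bH))).
rewrite !(counit_mul_leftE (counit_linear bH)).
by rewrite (counit_multiplicative bH).1 scale1r.
Qed.

(** Applying the counit to the left factor of the cocycle identity gives
    P h = eps (P h) . 1 + P h. *)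
Lemma counit_cocycle (P : H -> H) h : linear P ->
    (forall h, Delta (P h) = P h *t 1 + tensor_map id P (Delta h)) ->
  eps (P h) = 0.
Proof.
move=> lP DP; apply: eps_scalar0; apply: (addIr (P h)); rewrite add0r.
have := counit_left bH (P h); rewrite DP -/(counit_mul_left eps _).
rewrite (linD (counit_mul_left_lin (counit_linear bH))).
rewrite (counit_mul_leftE (counit_linear bH)) counit_mul_leftP //.
  by rewrite [counit_mul_left _ _](counit_left bH).
exact: counit_linear bH.
Qed.

End CounitValues.

(** * The bialgebra of forests *)

Section ForestBialgebra.
Variables (k : comNzRingType) (X Omega : Type).
Local Notation H := (HRT k X Omega).
Local Notation of_forest := (@of_forest k X Omega).
Local Notation DeltaRT := (@DeltaRT k X Omega).
Local Notation epsRT := (@epsRT k X Omega).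

Lemma epsRT_lin : scalar epsRT.
Proof. by move=> a x y; rewrite /epsRT mcoeffD mcoeffZ. Qed.

Lemma epsRT_morphism : monoid_morphism epsRT.
Proof.
split=> [|x y]; first by rewrite /epsRT mcoeff1 eqxx.
exact: (@mcoeff1g_is_multiplicative (forest X Omega) k).1.
Qed.

Lemma epsRT_of_forest F : epsRT (of_forest F) = (F == [::])%:R.
Proof. by rewrite /epsRT mcoeffU1. Qed.

Lemma epsRT_Bplus w h : epsRT (BplusRT w h) = 0.
Proof.
rewrite (forest_expansion h) (lin_sum _ _ _ (BplusRT_lin w)).
rewrite (lin_sum _ _ _ (epsRT_lin : linear (epsRT : H -> k^o))).
rewrite big1 // => F _; rewrite (linZ _ (BplusRT_lin w)) BplusRT_of_forest.
rewrite (linZ _ (epsRT_lin : linear (epsRT : H -> k^o))) epsRT_of_forest.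
by rewrite scaler0.
Qed.

Lemma HRT_is_bialgebra : is_bialgebra DeltaRT epsRT.
Proof.
have lD := @DeltaRT_lin k X Omega; have mD := @DeltaRT_morphism k X Omega.
have le := epsRT_lin; have me := epsRT_morphism.
split=> //.
- apply: HRT_ind => [a x y|| x y | x | w h].
  + exact: coassoc_at_lin.
  + exact: coassoc_at1.
  + exact: coassoc_atM.
  + by apply: coassoc_at_primitive => //; apply: DeltaRT_j.
  + have [lB DB] := DeltaRT_cocycle k X w.
    exact: (coassoc_at_cocycle lD mD lB DB).
- have ll := counit_mul_left_lin le.
  move=> h; rewrite -/(counit_mul_left epsRT _).
  elim/HRT_ind: h => [a x y ex ey|| x y ex ey| x | w h eh].
  + by rewrite lD ll ex ey.
  + by rewrite mD.1 (counit_mul_leftE le) me.1 scale1r.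
  + by rewrite mD.2 counit_mul_leftM // ex ey.
  + rewrite (DeltaRT_j _ _) (linD ll) !(counit_mul_leftE le) me.1 scale1r.
    by rewrite epsRT_of_forest scale0r add0r.
  + have [lB ->] := DeltaRT_cocycle k X w.
    rewrite (linD ll) counit_mul_leftP // eh counit_mul_leftE //.
    by rewrite epsRT_Bplus scale0r add0r.
- have lr := counit_mul_right_lin le.
  move=> h; rewrite -/(counit_mul_right epsRT _).
  elim/HRT_ind: h => [a x y ex ey|| x y ex ey| x | w h eh].
  + by rewrite lD lr ex ey.
  + by rewrite mD.1 (counit_mul_rightE le) me.1 scale1r.
  + by rewrite mD.2 counit_mul_rightM // ex ey.
  + rewrite (DeltaRT_j _ _) (linD lr) !(counit_mul_rightE le) me.1 scale1r.
    by rewrite epsRT_of_forest scale0r addr0.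
  + have [lB ->] := DeltaRT_cocycle k X w.
    rewrite (linD lr) counit_mul_rightP ?addr0; last exact: epsRT_Bplus.
    all: by rewrite // counit_mul_rightE // me.1 scale1r.
Qed.

End ForestBialgebra.

(** * The antipode of a connected graded bialgebra *)

Section AntipodeOfConnectedGraded.
Variables (k : comNzRingType) (H : algType k).
Variables (Delta : H -> tensor H H) (eps : H -> k) (A : nat -> H -> Prop).
Hypothesis gH : is_connected_graded_bialgebra Delta eps A.

Let bH := graded_bialgebra gH.
Let lD := comul_linear bH.
Let le := counit_linear bH.

Definition convolution (f g : H -> H) (h : H) : H :=
  tensor_lift (fun a b => f a * g b) (Delta h).

Let bmul (f g : H -> H) : linear f -> linear g ->
  bilinear_map (fun a b => f a * g b).
Proof. by move=> lf lg; apply: (bilinear_comp (bilinear_mul H)). Qed.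

Lemma convolution_lin f g : linear f -> linear g -> linear (convolution f g).
Proof.
by move=> lf lg; exact: lin_comp (tensor_lift_linear (bmul lf lg)) lD.
Qed.

(** Both sides apply the trilinear map (a, b, c) |-> f a * (g b * e c) to an
    iterated coproduct of h. *)
Lemma convolutionA f g e h : linear f -> linear g -> linear e ->
  convolution (convolution f g) e h = convolution f (convolution g e) h.
Proof.
move=> lf lg lE; have lge := tensor_lift_linear (bmul lg lE).
have bfge : bilinear_map (fun (a : H) (u : tensor H H) =>
    f a * tensor_lift (fun b c => g b * e c) u).
  exact: (bilinear_comp (bilinear_mul H) lf lge).
pose fge (s : tensor H (tensor H H)) :=
  tensor_lift (fun a u => f a * tensor_lift (fun b c => g b * e c) u) s.
have lfge : linear fge by exact: tensor_lift_linear.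
have lT1 := coassoc_left_lin lD; have lT2 := coassoc_right_lin lD.
have E1 t : tensor_lift (fun a b => convolution f g a * e b) t =
    fge (tensor_assoc (tensor_map Delta id t)).
  move: t; apply: tensor_eq.
  - exact: tensor_lift_linear (bmul (convolution_lin lf lg) lE).
  - exact: lin_comp lfge lT1.
  move=> a b; rewrite tensor_mapE //.
  rewrite tensor_liftE; last exact: bmul (convolution_lin lf lg) lE.
  rewrite /convolution; move: (Delta a); apply: tensor_eq.
  - exact: lin_comp ((bilinear_mul H).1 _) (tensor_lift_linear (bmul lf lg)).
  - exact: lin_comp lfge (lin_comp (@tensor_assoc_lin _ H H H) (tens_linl b)).
  move=> c d; rewrite tensor_assocE /fge !tensor_liftE ?mulrA //; exact: bmul.
have E2 t : tensor_lift (fun a b => f a * convolution g e b) t =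
    fge (tensor_map id Delta t).
  move: t; apply: tensor_eq.
  - exact: tensor_lift_linear (bmul lf (convolution_lin lg lE)).
  - exact: lin_comp lfge lT2.
  move=> a b; rewrite tensor_mapE // /fge [RHS]tensor_liftE //.
  by rewrite tensor_liftE //; exact: bmul lf (convolution_lin lg lE).
by rewrite {1}/convolution E1 (coassociative bH) -E2.
Qed.

Definition conv_unit (h : H) : H := (eps h)%:A.

(** The antipode inverts id = conv_unit - reduced_id for the convolution, and
    is therefore the geometric series in this map. *)
Definition reduced_id (h : H) : H := conv_unit h - h.

Definition reduced_power n : H -> H :=
  iter n (convolution reduced_id) conv_unit.

Lemma conv_unit_lin : linear conv_unit.
Proof. by move=> a x y; rewrite /conv_unit le scalerDl scalerA. Qed.

Lemma reduced_id_lin : linear reduced_id.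
Proof.
by move=> a x y; rewrite /reduced_id conv_unit_lin scalerBr opprD addrACA.
Qed.

Lemma reduced_power_lin n : linear (reduced_power n).
Proof.
elim: n => [|n IH]; first exact: conv_unit_lin.
exact: convolution_lin reduced_id_lin IH.
Qed.

Lemma conv_unit_left f h : linear f -> convolution conv_unit f h = f h.
Proof.
move=> lf; rewrite -{2}(counit_left bH h).
rewrite -[tensor_lift _ _]/(counit_mul_left eps _).
rewrite /convolution; move: (Delta h); apply: tensor_eq.
- exact: tensor_lift_linear (bmul conv_unit_lin lf).
- exact: lin_comp lf (counit_mul_left_lin le).
move=> a b; rewrite tensor_liftE; last exact: (bmul conv_unit_lin lf).
by rewrite counit_mul_leftE // (linZ _ lf) -scalerAl mul1r.
Qed.

Lemma conv_unit_right f h : linear f -> convolution f conv_unit h = f h.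
Proof.
move=> lf; rewrite -{2}(counit_right bH h).
rewrite -[tensor_lift _ _]/(counit_mul_right eps _).
rewrite /convolution; move: (Delta h); apply: tensor_eq.
- exact: tensor_lift_linear (bmul lf conv_unit_lin).
- exact: lin_comp lf (counit_mul_right_lin le).
move=> a b; rewrite tensor_liftE; last exact: (bmul lf conv_unit_lin).
by rewrite counit_mul_rightE // (linZ _ lf) -scalerAr mulr1.
Qed.

(** The powers are built by multiplying on the left; since they also commute
    with [reduced_id], the geometric series is a two-sided inverse. *)
Lemma reduced_powerSr n h :
  convolution (reduced_power n) reduced_id h = reduced_power n.+1 h.
Proof.
have lr := reduced_id_lin.
elim: n h => [|n IH] h.
  by rewrite conv_unit_left //; exact/esym/conv_unit_right.
rewrite convolutionA //; last exact: reduced_power_lin.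
by congr convolution; apply/funext.
Qed.

Lemma id_reduced h : h = conv_unit h - reduced_id h.
Proof. by rewrite /reduced_id subKr. Qed.

Lemma conv_power_id n h :
  convolution (reduced_power n) id h = reduced_power n h - reduced_power n.+1 h.
Proof.
have lp := reduced_power_lin n.
rewrite -reduced_powerSr -{1}(conv_unit_right h lp) /convolution.
move: (Delta h) => t.
have l1 := tensor_lift_linear (bmul lp (@lin_id _ H)).
have l2 := tensor_lift_linear (bmul lp conv_unit_lin).
have l3 := tensor_lift_linear (bmul lp reduced_id_lin).
elim/tensor_ind: t => [|s t IHs IHt|a b].
- by rewrite (lin0 l1) (lin0 l2) (lin0 l3) subr0.
- by rewrite (linD l1) (linD l2) (linD l3) IHs IHt opprD addrACA.
rewrite !tensor_liftE; [|exact: (bmul lp reduced_id_lin)|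
  exact: (bmul lp conv_unit_lin)|exact: (bmul lp (@lin_id _ H))].
by rewrite -mulrBr -id_reduced.
Qed.

Lemma conv_id_power n h :
  convolution id (reduced_power n) h = reduced_power n h - reduced_power n.+1 h.
Proof.
have lp := reduced_power_lin n.
rewrite [reduced_power n.+1 h]/(convolution reduced_id (reduced_power n) h).
rewrite -{1}(conv_unit_left h lp) /convolution.
move: (Delta h) => t.
have l1 := tensor_lift_linear (bmul (@lin_id _ H) lp).
have l2 := tensor_lift_linear (bmul conv_unit_lin lp).
have l3 := tensor_lift_linear (bmul reduced_id_lin lp).
elim/tensor_ind: t => [|s t IHs IHt|a b].
- by rewrite (lin0 l1) (lin0 l2) (lin0 l3) subr0.
- by rewrite (linD l1) (linD l2) (linD l3) IHs IHt opprD addrACA.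
rewrite !tensor_liftE; [|exact: (bmul reduced_id_lin lp)|
  exact: (bmul conv_unit_lin lp)|exact: (bmul (@lin_id _ H) lp)].
by rewrite -mulrBl -id_reduced.
Qed.

(** In the coproduct of h, a left factor of degree 0 is a scalar, which
    [reduced_id] kills, and a left factor of positive degree leaves a right
    factor of degree smaller than d. *)
Lemma reduced_power_homogeneous n d h :
  A d h -> (d < n)%N -> reduced_power n h = 0.
Proof.
elim: n d h => // n IH d h Ah ltdn; have lp := reduced_power_lin n.
have bl := bmul reduced_id_lin lp.
rewrite [LHS]/(convolution reduced_id (reduced_power n) h) /convolution.
have [s [-> As]] := graded_comul gH Ah.
rewrite (lin_sum _ _ _ (tensor_lift_linear bl)) big_seq big1 // => -[a b] abs.
rewrite tensor_liftE //=; have [p [q [pqd /= Aa Ab]]] := As _ abs.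
case: p pqd Aa => [|p] pqd Aa; last first.
  by rewrite (IH q) ?mulr0 // (leq_trans _ (ltnSE ltdn)) // -pqd ltnS leq_addl.
have [c ->] := graded_connected gH Aa.
suff -> : reduced_id c%:A = 0 by rewrite mul0r.
rewrite (linZ _ reduced_id_lin) /reduced_id /conv_unit.
by rewrite (counit_multiplicative bH).1 scale1r subrr scaler0.
Qed.

Lemma reduced_power_nilpotent h :
  exists N, forall n, (N <= n)%N -> reduced_power n h = 0.
Proof.
have [N [c [Ac ->]]] := graded_span gH h; exists N => n leNn.
rewrite (lin_sum _ _ _ (reduced_power_lin n)) big1 // => i _.
by apply: reduced_power_homogeneous (Ac i) _; apply: leq_trans leNn.
Qed.

(** The number of terms needed for the series at x and y is not bounded
    uniformly, but a tensor involves only finitely many pairs. *)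
Lemma tensor_lift_locally_finite (b : H -> H -> H) (bn : nat -> H -> H -> H) :
    bilinear_map b -> (forall n, bilinear_map (bn n)) ->
    (forall x y, exists M0, forall M, (M0 <= M)%N ->
       b x y = \sum_(n < M) bn n x y) ->
  forall t, exists M0, forall M, (M0 <= M)%N ->
    tensor_lift b t = \sum_(n < M) tensor_lift (bn n) t.
Proof.
move=> bb bbn bE; have lb := tensor_lift_linear bb.
have lbn n := tensor_lift_linear (bbn n).
elim/tensor_ind => [|s t [M1 E1] [M2 E2]|x y].
- by exists 0 => M _; rewrite (lin0 lb) big1 // => n _; exact: (lin0 (lbn n)).
- exists (maxn M1 M2) => M; rewrite geq_max => /andP[/E1 e1 /E2 e2].
  rewrite (linD lb) e1 e2 -big_split; apply: eq_bigr => n _.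
  by rewrite (linD (lbn n)).
have [M0 E0] := bE x y; exists M0 => M /E0.
by rewrite tensor_liftE // => ->; apply: eq_bigr => n _; rewrite tensor_liftE.
Qed.

(** The convolution of the series with id telescopes to conv_unit. *)
Theorem connected_graded_antipode : exists S, is_antipode Delta eps S.
Proof.
(* N h bounds the terms of the series that do not vanish at h; any larger
   bound gives the same sum, so S may be expanded with a common one. *)
have [N N0] := choice reduced_power_nilpotent.
pose S h := \sum_(n < N h) reduced_power n h.
have SE h M : (N h <= M)%N -> S h = \sum_(n < M) reduced_power n h.
  move=> leM; rewrite /S -!(big_mkord xpredT (fun n => reduced_power n h)).
  rewrite [RHS](@big_cat_nat _ _ _ (N h)) //=.
  rewrite [X in _ + X]big_nat_cond [X in _ + X]big1 ?addr0 //.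
  by move=> n /andP[/andP[/N0]].
have lS : linear S.
  move=> a x y; pose M := maxn (N (a *: x + y)) (maxn (N x) (N y)).
  rewrite !(SE _ M) ?leq_maxl //.
  - rewrite scaler_sumr -big_split; apply: eq_bigr => n _.
    exact: reduced_power_lin.
  - by rewrite !leq_max leqnn !orbT.
  - by rewrite !leq_max leqnn !orbT.
have telescope h M : (N h <= M)%N ->
    \sum_(n < M) (reduced_power n h - reduced_power n.+1 h) = (eps h)%:A.
  move=> leM; rewrite -(big_mkord xpredT
    (fun n => reduced_power n h - reduced_power n.+1 h)).
  rewrite (telescope_sumr_eq (fun n => - reduced_power n h)) //.
    by rewrite N0 // oppr0 sub0r opprK.
  by move=> n _; rewrite opprK addrC.
have S_left a b : exists M0, forall M, (M0 <= M)%N ->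
    S a * b = \sum_(n < M) reduced_power n a * b.
  by exists (N a) => M /SE->; rewrite mulr_suml.
have S_right a b : exists M0, forall M, (M0 <= M)%N ->
    a * S b = \sum_(n < M) a * reduced_power n b.
  by exists (N b) => M /SE->; rewrite mulr_sumr.
exists S; split=> // h.
- have [M0 EM] := tensor_lift_locally_finite (bmul lS (@lin_id _ H))
    (fun n => bmul (reduced_power_lin n) (@lin_id _ H)) S_left (Delta h).
  rewrite (EM (maxn M0 (N h)) (leq_maxl _ _)).
  rewrite -(telescope h (maxn M0 (N h)) (leq_maxr _ _)).
  by apply: eq_bigr => n _; rewrite -conv_power_id.
- have [M0 EM] := tensor_lift_locally_finite (bmul (@lin_id _ H) lS)
    (fun n => bmul (@lin_id _ H) (reduced_power_lin n)) S_right (Delta h).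
  rewrite (EM (maxn M0 (N h)) (leq_maxl _ _)).
  rewrite -(telescope h (maxn M0 (N h)) (leq_maxr _ _)).
  by apply: eq_bigr => n _; rewrite -conv_id_power.
Qed.

End AntipodeOfConnectedGraded.

(** * The grading by the number of vertices *)

Section ForestGrading.
Variables (k : comNzRingType) (X Omega : Type).
Local Notation H := (HRT k X Omega).
Local Notation of_forest := (@of_forest k X Omega).
Local Notation homogeneous := (@homogeneousRT k X Omega).

Lemma forest_degree_cat (F G : forest X Omega) :
  forest_degree (F ++ G) = (forest_degree F + forest_degree G)%N.
Proof. by rewrite /forest_degree map_cat sumn_cat. Qed.

Lemma forest_degree_node w (F : forest X Omega) :
  forest_degree [:: Node w F] = (forest_degree F).+1.
Proof. by rewrite /forest_degree /= addn0. Qed.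

Lemma forest_degree_eq0 (F : forest X Omega) : forest_degree F = 0 -> F = [::].
Proof. by case: F => [//|[x|w G] F]. Qed.

(** A marking splits the vertices of F between G and F / G. *)
Lemma degree_markings (F : forest X Omega) M : M \in markings F ->
  (forest_degree (part true M) + forest_degree (part false M))%N =
  forest_degree F.
Proof.
elim/forest_ind: F M => [|x F IH|w G F IHG IHF] M.
- by rewrite inE => /eqP->.
- move=> /allpairsP[[m N] /= [mx /IH NF ->]].
  rewrite /part /= !forest_degree_cat addnACA NF.
  by congr (_ + _)%N; move: mx; rewrite !inE => /orP[]/eqP->.
move=> /allpairsP[[m N] /= [mw /IHF NF ->]].
rewrite /part /= !forest_degree_cat addnACA NF -cat1s forest_degree_cat.
congr (_ + _)%N; rewrite forest_degree_node.
move: mw; rewrite mem_cat => /orP[] /mapP[L /IHG <- ->] /=.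
  by rewrite forest_degree_node.
by rewrite forest_degree_node addnS.
Qed.

Lemma homogeneousP n h : homogeneous n h <->
  forall F, forest_degree F != n -> h@_F = 0.
Proof.
split=> hn F.
  by move=> Fn; apply: mcoeff_outdom; apply: contraNN Fn => /hn/eqP.
by rewrite -mcoeff_neq0 => h0; apply/eqP; apply: contraNT h0 => /hn->.
Qed.

Lemma homogeneous_of_forest F : homogeneous (forest_degree F) (of_forest F).
Proof.
apply/homogeneousP => G; rewrite mcoeffU1.
by case: (F =P G) => [->|//]; rewrite eqxx.
Qed.

Lemma homogeneous0 n : homogeneous n 0.
Proof. by apply/homogeneousP => F _; rewrite mcoeff0. Qed.

Lemma homogeneous_lin n a x y :
  homogeneous n x -> homogeneous n y -> homogeneous n (a *: x + y).
Proof.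
move=> /homogeneousP hx /homogeneousP hy; apply/homogeneousP => F Fn.
by rewrite mcoeffD mcoeffZ hx // hy // mulr0 addr0.
Qed.

Lemma homogeneous_sum n (I : eqType) (r : seq I) (P : pred I) (f : I -> H)
    (c : I -> k) :
  (forall i, i \in r -> P i -> homogeneous n (f i)) ->
  homogeneous n (\sum_(i <- r | P i) c i *: f i).
Proof.
move=> hf; rewrite big_seq_cond; apply: big_ind => [|x y hx hy|i /andP[ir Pi]].
- exact: homogeneous0.
- by rewrite -[x]scale1r; apply: homogeneous_lin.
- by rewrite -[_ *: _]addr0; apply: homogeneous_lin (homogeneous0 n); apply: hf.
Qed.

Lemma homogeneousM p q x y :
  homogeneous p x -> homogeneous q y -> homogeneous (p + q) (x * y).
Proof.
move=> hx hy; rewrite (forest_expansion x) mulr_suml.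
under eq_bigr do rewrite -scalerAl.
apply: homogeneous_sum => F /hx <- _; rewrite (forest_expansion y) mulr_sumr.
under eq_bigr do rewrite -scalerAr -of_forest_cat.
apply: homogeneous_sum => G /hy <- _; rewrite -forest_degree_cat.
exact: homogeneous_of_forest.
Qed.

Definition homogeneous_part n (h : H) : H :=
  \sum_(F <- msupp h | forest_degree F == n) h@_F *: of_forest F.

Lemma homogeneous_partP n h : homogeneous n (homogeneous_part n h).
Proof.
by apply: homogeneous_sum => F _ /eqP <-; apply: homogeneous_of_forest.
Qed.

Lemma homogeneous_decomposition h :
  h = \sum_(n < (\max_(F <- msupp h) forest_degree F).+1) homogeneous_part n h.
Proof.
rewrite {1}[h]forest_expansion /homogeneous_part.
under [RHS]eq_bigr do rewrite big_mkcond /=.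
rewrite exchange_big /= big_seq [RHS]big_seq; apply: eq_bigr => F Fh.
have ltF : (forest_degree F < (\max_(F <- msupp h) forest_degree F).+1)%N.
  rewrite ltnS.
  exact: (@leq_bigmax_seq _ _ xpredT (@forest_degree X Omega) F).
rewrite (bigD1 (Ordinal ltF)) //= eqxx big1 ?addr0 // => i.
by rewrite -val_eqE /= eq_sym => /negPf->.
Qed.

Lemma DeltaRT_homogeneous n h : homogeneous n h -> exists s : seq (H * H),
  DeltaRT h = \sum_(ab <- s) ab.1 *t ab.2 /\
  (forall ab, ab \in s ->
     exists p q, [/\ (p + q)%N = n, homogeneous p ab.1 & homogeneous q ab.2]).
Proof.
move=> hn.
exists [seq (h@_F *: of_forest (part true M), of_forest (part false M))
       | F <- msupp h,
         M <- [seq M <- markings F | all (@descendant_closed X Omega) M]].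
split.
  rewrite big_allpairs_dep {1}(forest_expansion h).
  rewrite (lin_sum _ _ _ (@DeltaRT_lin k X Omega)); apply: eq_bigr => F _.
  rewrite (linZ _ (@DeltaRT_lin k X Omega)) DeltaRT_of_forest scaler_sumr.
  by rewrite big_filter; apply: eq_bigr => M _; rewrite tensZl.
move=> ab /allpairsPdep[F [M [/hn Fn]]].
rewrite mem_filter => /andP[_ /degree_markings MF] -> /=.
exists (forest_degree (part true M)), (forest_degree (part false M)).
split; [by rewrite MF| |exact: homogeneous_of_forest].
rewrite -[_ *: _]addr0; apply: homogeneous_lin (homogeneous0 _).
exact: homogeneous_of_forest.
Qed.

Theorem HRT_connected_graded :
  is_connected_graded_bialgebra (@DeltaRT k X Omega) (@epsRT k X Omega)
    homogeneous.
Proof.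
split.
- exact: HRT_is_bialgebra.
- exact: homogeneous0.
- exact: homogeneous_lin.
- move=> h; exists (\max_(F <- msupp h) forest_degree F).+1.
  exists (fun n => homogeneous_part n h); split=> [n|].
    exact: homogeneous_partP.
  exact: homogeneous_decomposition.
- move=> N c hc c0 n ltnN; apply/malgP=> F; rewrite mcoeff0.
  have [Fn|Fn] := eqVneq (forest_degree F) n; last first.
    by move/homogeneousP: (hc n); apply.
  have := congr1 (mcoeff F) c0; rewrite mcoeff0 raddf_sum /=.
  rewrite (bigD1 (Ordinal ltnN)) //= big1 ?addr0 // => i ni.
  by move/homogeneousP: (hc i); apply; rewrite Fn eq_sym.
- exact: (@homogeneous_of_forest [::]).
- exact: homogeneousM.
- exact: DeltaRT_homogeneous.
- by move=> n h n0 /homogeneousP; apply; rewrite eq_sym -lt0n.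
- move=> h /homogeneousP h0; exists (epsRT h); apply/malgP=> F.
  rewrite mcoeffZ mcoeff1; have [->|F0] := eqVneq F [::].
    by rewrite mulr1.
  rewrite mulr0 h0 //.
  by apply: contra_neq F0 => /forest_degree_eq0.
Qed.

End ForestGrading.

(** * The universal property *)

Section UniversalProperty.
Variables (k : comNzRingType) (X Omega : Type).
Variables (H : algType k) (Delta : H -> tensor H H) (eps : H -> k).
Variables (P : Omega -> H -> H) (f : X -> H).
Hypotheses (bH : is_bialgebra Delta eps) (cP : is_cocycle_operators Delta P).
Hypothesis pf : forall x, is_primitive Delta (f x).
Local Notation HF := (HRT k X Omega).

(** The inner fold is [forest_eval], inlined because the recursion on nested
    trees must see it. *)
Fixpoint tree_eval (t : tree X Omega) : H :=
  match t with
  | Leaf x => f x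
  | Node w F => P w (foldr (fun s a => tree_eval s * a) 1 F)
  end.

Definition forest_eval (F : forest X Omega) : H :=
  foldr (fun s a => tree_eval s * a) 1 F.

Lemma forest_eval_cat F G :
  forest_eval (F ++ G) = forest_eval F * forest_eval G.
Proof. by elim: F => [|t F IH] /=; rewrite ?mul1r // IH mulrA. Qed.

Definition HRT_eval : HF -> H := linear_ext forest_eval.

Lemma HRT_eval_of_forest F : HRT_eval (of_forest k F) = forest_eval F.
Proof. exact: linear_extU. Qed.

Lemma HRT_eval_lin : linear HRT_eval.
Proof. exact: linearP. Qed.

Lemma HRT_eval_morphism : monoid_morphism HRT_eval.
Proof.
split=> [|x y]; first by rewrite -[1]of_forest_nil HRT_eval_of_forest.
have [Fl Fr] := bilinear_mul HF; have [Hl Hr] := bilinear_mul H.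
move: x; apply: HRT_lin_eq.
- exact: lin_comp HRT_eval_lin (Fl y).
- exact: lin_comp (Hl _) HRT_eval_lin.
move=> F; move: y; apply: HRT_lin_eq.
- exact: lin_comp HRT_eval_lin (Fr _).
- exact: lin_comp (Hr _) HRT_eval_lin.
by move=> G; rewrite -of_forest_cat !HRT_eval_of_forest forest_eval_cat.
Qed.

Lemma HRT_eval_j x : HRT_eval (jRT k Omega x) = f x.
Proof. by rewrite HRT_eval_of_forest /= mulr1. Qed.

Lemma HRT_eval_Bplus w h : HRT_eval (BplusRT w h) = P w (HRT_eval h).
Proof.
move: h; apply: HRT_lin_eq.
- exact: lin_comp HRT_eval_lin (BplusRT_lin w).
- exact: lin_comp (cP w).1 HRT_eval_lin.
by move=> F; rewrite BplusRT_of_forest !HRT_eval_of_forest /= mulr1.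
Qed.

Lemma HRT_eval_comul h :
  Delta (HRT_eval h) = tensor_map HRT_eval HRT_eval (DeltaRT h).
Proof.
have le := HRT_eval_lin; have me := HRT_eval_morphism.
have lD := comul_linear bH; have mD := comul_multiplicative bH.
have lDF := @DeltaRT_lin k X Omega; have mDF := @DeltaRT_morphism k X Omega.
have lee := tensor_map_lin le le.
elim/HRT_ind: h => [a x y IHx IHy||x y IHx IHy|x|w h IH].
- by rewrite le lD IHx IHy lDF lee.
- by rewrite me.1 mD.1 mDF.1 tensor_mapE // me.1.
- by rewrite me.2 mD.2 IHx IHy mDF.2 tensor_map_mul.
- rewrite HRT_eval_j pf (DeltaRT_j k Omega) (linD lee) !tensor_mapE //.
  by rewrite HRT_eval_j me.1.
have [lP DP] := cP w; have [lB DB] := DeltaRT_cocycle k X w.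
rewrite HRT_eval_Bplus DP IH DB (linD lee) tensor_mapE // me.1 HRT_eval_Bplus.
congr (_ + _); move: (DeltaRT h); apply: tensor_eq.
- exact: lin_comp (tensor_map_lin (@lin_id _ H) lP) lee.
- exact: lin_comp lee (tensor_map_lin (@lin_id _ HF) lB).
by move=> a b; rewrite !tensor_mapE // HRT_eval_Bplus.
Qed.

Lemma HRT_eval_counit h : eps (HRT_eval h) = epsRT h.
Proof.
have le := HRT_eval_lin; have me := HRT_eval_morphism.
have leps := counit_linear bH; have meps := counit_multiplicative bH.
have lF := @epsRT_lin k X Omega; have mF := @epsRT_morphism k X Omega.
elim/HRT_ind: h => [a x y IHx IHy||x y IHx IHy|x|w h IH].
- by rewrite le leps IHx IHy lF.
- by rewrite me.1 meps.1 mF.1.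
- by rewrite me.2 meps.2 IHx IHy mF.2.
- by rewrite HRT_eval_j (counit_primitive bH (pf x)) epsRT_of_forest.
have [lP DP] := cP w.
by rewrite HRT_eval_Bplus (counit_cocycle bH _ lP DP) epsRT_Bplus.
Qed.

Lemma HRT_eval_hom : is_operated_bialgebra_hom
  (@DeltaRT k X Omega) (@epsRT k X Omega) (@BplusRT k X Omega)
  Delta eps P HRT_eval.
Proof.
split; [exact: HRT_eval_lin|exact: HRT_eval_morphism|exact: HRT_eval_comul|
        exact: HRT_eval_counit|exact: HRT_eval_Bplus].
Qed.

(** For uniqueness, the elements where two morphisms agree contain the
    generators and are stable under all the operations. *)
Theorem HRT_universal : exists! phi : HF -> H,
  is_operated_bialgebra_hom (@DeltaRT k X Omega) (@epsRT k X Omega)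
    (@BplusRT k X Omega) Delta eps P phi /\
  (forall x, phi (jRT k Omega x) = f x).
Proof.
exists HRT_eval; split.
  by split; [exact: HRT_eval_hom | exact: HRT_eval_j].
move=> psi [hpsi psij]; apply/funext.
have lpsi := hom_linear hpsi; have mpsi := hom_multiplicative hpsi.
have le := HRT_eval_lin; have me := HRT_eval_morphism.
elim/HRT_ind=> [a x y IHx IHy||x y IHx IHy|x|w h IH].
- by rewrite le lpsi IHx IHy.
- by rewrite me.1 mpsi.1.
- by rewrite me.2 mpsi.2 IHx IHy.
- by rewrite HRT_eval_j psij.
by rewrite HRT_eval_Bplus (hom_operators hpsi) IH.
Qed.

End UniversalProperty.

Theorem theorem2p10 (k : comNzRingType) (X Omega : Type)
    (Omega_nonempty : inhabited Omega) :
  is_free_cocycle_bialgebra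
    (@DeltaRT k X Omega) (@epsRT k X Omega) (@BplusRT k X Omega) (@jRT k X Omega)
  /\
  (is_connected_graded_bialgebra
     (@DeltaRT k X Omega) (@epsRT k X Omega) (@homogeneousRT k X Omega)
   /\
   is_free_cocycle_hopf_algebra
     (@DeltaRT k X Omega) (@epsRT k X Omega) (@BplusRT k X Omega) (@jRT k X Omega)).
Proof.
have bF := @HRT_is_bialgebra k X Omega.
have cF := @DeltaRT_cocycle k X Omega.
have gF := @HRT_connected_graded k X Omega.
split; first by split=> // H D e P f [bH cP] pf; apply: HRT_universal.
split=> //; split.
  by split=> //; split=> //; apply: connected_graded_antipode gF.
by move=> H D e P f [[bH _] cP] pf; apply: HRT_universal.
Qed.
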